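(* For $n\ge0$ define $$\widehat{\widehat P}_n(x_1,x_2,y_1,\hat y_2,u_1,u_2,v_1,\hat v_2,w_{\mathrm e},w_{\mathrm o},z_{\mathrm e},z_{\mathrm o},\lambda)=\sum_{\sigma\in\mathfrak D_{2n}}x_1^{\mathrm{eareccpeak}(\sigma)}x_2^{\mathrm{eareccdfall}(\sigma)}y_1^{\mathrm{ereccval}(\sigma)}\hat y_2^{\mathrm{ereccdrise}'(\sigma)}u_1^{\mathrm{nrcpeak}(\sigma)}u_2^{\mathrm{nrcdfall}(\sigma)}v_1^{\mathrm{nrcval}(\sigma)}\hat v_2^{\mathrm{nrcdrise}'(\sigma)}w_{\mathrm e}^{\mathrm{evennrfix}(\sigma)}w_{\mathrm o}^{\mathrm{oddnrfix}(\sigma)}z_{\mathrm e}^{\mathrm{evenrar}(\sigma)}z_{\mathrm o}^{\mathrm{oddrar}(\sigma)}\lambda^{\mathrm{cyc}(\sigma)}.$$ Then $\sum_{n\ge0}\widehat{\widehat P}_n(x_1,x_2,y_1,\hat y_2,u_1,u_2,y_1,\hat v_2,w_{\mathrm e},w_{\mathrm o},z_{\mathrm e},z_{\mathrm o},\lambda)\,t^n$ (i.e. with $v_1=y_1$) equals the T-type continued fraction with coefficients $\alpha_{2k-1}=(\lambda+k-1)\,[x_1+(k-1)u_1]\,y_1$, $\alpha_{2k}=[x_2+(k-1)u_2+\lambda w_{\mathrm e}]\,[\hat y_2+(k-1)\hat v_2+\lambda w_{\mathrm o}]$ for $k\ge1$, $\delta_1=\lambda^2z_{\mathrm e}z_{\mathrm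 o}$, $\delta_n=0$ for $n\ge2$.
   Context: $\mathfrak D_{2n}$: permutations $\sigma$ of $[2n]$ with $\sigma(2k-1)\ge2k-1$ and $\sigma(2k)\le2k$ for all $k\in[n]$. $\mathrm{cyc}(\sigma)$ is the number of cycles of $\sigma$ (fixed points count as cycles). Index $i$ is a cycle peak / valley / double rise / double fall if respectively $\sigma^{-1}(i)<i>\sigma(i)$ / $\sigma^{-1}(i)>i<\sigma(i)$ / $\sigma^{-1}(i)<i<\sigma(i)$ / $\sigma^{-1}(i)>i>\sigma(i)$. Record: $\sigma(j)<\sigma(i)$ for all $j<i$; antirecord: $\sigma(j)>\sigma(i)$ for all $j>i$; exclusive record = record not antirecord; exclusive antirecord = antirecord not record; record-antirecord = both; neither-record-antirecord = neither. $\mathrm{eareccpeak},\mathrm{eareccdfall}$ = number of exclusive antirecords that are cycle peaks, resp. cycle double falls; $\mathrm{ereccval}$ = exclusive records that are cycle valleys; $\mathrm{nrcpeak},\mathrm{nrcdfall},\mathrm{nrcval}$ = neither-record-antirecords that are cycle peaks, double falls, valleys; $\mathrm{ereccdrise}'(\sigma)$ = number of cycle double rises $i$ such that $\sigma^{-1}(i)$ is a record; $\mathrm{nrcdrise}'(\sigma)$ = number of cycle double rises $i$ such that $\sigma^{-1}(i)$ is not a record; $\mathrm{evennrfix},\mathrm{oddnrfix}$ = even/odd fixed points that are neither-record-antirecords; $\mathrm{evenrar},\mathrm{oddrar}$ = even/odd record-antirecords. T-type continued fraction with coefficients $(\alpha_n),(\delta_n)$: the formal power series $1/(1-\delta_1t-\alpha_1t/(1-\delta_2t-\alpha_2t/(1-\delta_3t-\cdots)))$.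 *)

(* Defs.v *)
From HB Require Import structures.
From mathcomp Require Import all_boot all_order all_algebra all_fingroup.

Set Implicit Arguments.
Unset Strict Implicit.
Unset Printing Implicit Defensive.

Import GRing.Theory.

(* A permutation of [1, m] is an element of 'S_m, that is, of {perm 'I_m}:
   i : 'I_m stands for the integer i.+1.  Comparisons of indices are not
   affected by this shift, but parities are: [lab i] is the true integer. *)
Section Permutations.
Local Open Scope nat_scope.
Variable m : nat.
Implicit Types (s : 'S_m) (i : 'I_m).

Definition lab i : nat := i.+1.

Definition sinv s i : 'I_m := (s^-1)%g i.

Definition cpeak s i : bool := (sinv s i < i) && (s i < i).
Definition cval s i : bool := (i < sinv s i) && (i < s i).
Definition cdrise s i : bool := (sinv s i < i) && (i < s i).
Definition cdfall s i : bool := (i < sinv s i) && (s i < i).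
Definition fixpt s i : bool := s i == i.

Definition record s i : bool := [forall j : 'I_m, (j < i) ==> (s j < s i)].
Definition antirecord s i : bool := [forall j : 'I_m, (i < j) ==> (s i < s j)].
Definition erec s i : bool := record s i && ~~ antirecord s i.
Definition earec s i : bool := antirecord s i && ~~ record s i.
Definition rar s i : bool := record s i && antirecord s i.
Definition nrar s i : bool := ~~ record s i && ~~ antirecord s i.

Definition eareccpeak s : nat := #|[set i | earec s i && cpeak s i]|.
Definition eareccdfall s : nat := #|[set i | earec s i && cdfall s i]|.
Definition ereccval s : nat := #|[set i | erec s i && cval s i]|.
Definition ereccdrise' s : nat :=
  #|[set i | cdrise s i && record s (sinv s i)]|.
Definition nrcpeak s : nat := #|[set i | nrar s i && cpeak s i]|.
Definition nrcdfall s : nat := #|[set i | nrar s i && cdfall s i]|.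
Definition nrcval s : nat := #|[set i | nrar s i && cval s i]|.
Definition nrcdrise' s : nat :=
  #|[set i | cdrise s i && ~~ record s (sinv s i)]|.
Definition evennrfix s : nat :=
  #|[set i | [&& ~~ odd (lab i), fixpt s i & nrar s i]]|.
Definition oddnrfix s : nat :=
  #|[set i | [&& odd (lab i), fixpt s i & nrar s i]]|.
Definition evenrar s : nat := #|[set i | ~~ odd (lab i) && rar s i]|.
Definition oddrar s : nat := #|[set i | odd (lab i) && rar s i]|.
Definition cyc s : nat := #|porbits s|.

Definition Dperm s : bool :=
  [forall i : 'I_m, if odd (lab i) then lab i <= lab (s i)
                                   else lab (s i) <= lab i].

End Permutations.

Local Open Scope ring_scope.

(* The polynomial is given by its values: R may be any commutative ring, in
   particular a polynomial ring whose indeterminates are x1, ..., lam. *)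
Definition Phathat (R : comNzRingType) (n : nat)
    (x1 x2 y1 y2h u1 u2 v1 v2h we wo ze zo lam : R) : R :=
  \sum_(s : 'S_(2 * n)%N | Dperm s)
    x1 ^+ eareccpeak s * x2 ^+ eareccdfall s *
    y1 ^+ ereccval s * y2h ^+ ereccdrise' s *
    u1 ^+ nrcpeak s * u2 ^+ nrcdfall s *
    v1 ^+ nrcval s * v2h ^+ nrcdrise' s *
    we ^+ evennrfix s * wo ^+ oddnrfix s *
    ze ^+ evenrar s * zo ^+ oddrar s * lam ^+ cyc s.

(* A formal power series in t is its sequence of coefficients. *)
Definition fps (R : comNzRingType) : Type := nat -> R.

Section PowerSeries.
Variable R : comNzRingType.
Implicit Types (f g h : fps R).

Definition fps0 : fps R := fun _ => 0.
Definition fpsC (c : R) : fps R := fun n => if n is 0%N then c else 0.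
Definition fps_add f g : fps R := fun n => f n + g n.
Definition fps_scale (c : R) f : fps R := fun n => c * f n.
Definition fps_mulX f : fps R := fun n => if n is m.+1 then f m else 0.
Definition fps_mul f g : fps R := fun n => \sum_(i < n.+1) f i * g (n - i)%N.
Definition fps_exp f (k : nat) : fps R := iter k (fps_mul f) (fpsC 1).

(* 1 / (1 - h) for h with zero constant term: the sum of all the h ^ k, where
   only k <= n matter for the coefficient of t ^ n.  See [fps_geomP]. *)
Definition fps_geom h : fps R := fun n => \sum_(k < n.+1) fps_exp h k n.

Lemma fps_exp_ord h k n : h 0%N = 0 -> (n < k)%N -> fps_exp h k n = 0.
Proof.
move=> h0; elim: k n => // k IHk n lt_nk.
rewrite /fps_exp iterS -/(fps_exp h k) /fps_mul big1 // => -[[|i] lt_in] _ /=.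
  by rewrite h0 mul0r.
rewrite IHk ?mulr0 //.
case: n lt_nk lt_in => // n lt_nk _.
by rewrite subSS (leq_ltn_trans (leq_subr i n)).
Qed.

Lemma fps_geomP h : h 0%N = 0 ->
  fps_mul (fps_add (fpsC 1) (fps_scale (-1) h)) (fps_geom h) =1 fpsC 1.
Proof.
move=> h0 n.
have E : fps_mul h (fps_geom h) n = \sum_(k < n.+1) fps_exp h k.+1 n.
  rewrite /fps_mul /= exchange_big /=; apply: eq_bigr => i _.
  rewrite -mulr_sumr; congr (_ * _); rewrite /fps_geom.
  rewrite (big_ord_widen n.+1 (fun k => fps_exp h k (n - i)%N))
          ?ltnS ?leq_subr //.
  rewrite [RHS](bigID (fun k : 'I_n.+1 => (k < (n - i).+1)%N)) /=.
  rewrite [X in _ = _ + X]big1 ?addr0 // => k; rewrite ltnS -ltnNge => lt_k.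
  exact: fps_exp_ord.
rewrite [LHS]/fps_mul (eq_bigr (fun i : 'I_n.+1 =>
  fpsC 1 i * fps_geom h (n - i)%N - h i * fps_geom h (n - i)%N)); last first.
  by move=> i _; rewrite /fps_add /fps_scale mulrDl mulN1r mulNr.
rewrite sumrB -[X in _ - X]/(fps_mul h (fps_geom h) n) E.
rewrite big_ord_recl /= mul1r subn0 big1 ?addr0; last first.
  by move=> i _; rewrite mul0r.
rewrite [X in _ - X]big_ord_recr /=.
have /= -> := @fps_exp_ord h n.+1 n h0 (ltnSn n); rewrite addr0.
by rewrite /fps_geom big_ord_recl /= addrK.
Qed.

(* The N-th truncation, starting at level k, of the T-type continued fraction
     1 / (1 - delta_k t - alpha_k t / (1 - delta_(k+1) t - ...)):
   the tail from level k + N on is replaced by 0. *)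
Fixpoint Tconvergent (alpha delta : nat -> R) (N k : nat) : fps R :=
  if N is N'.+1 then
    fps_geom (fps_mulX (fps_add (fpsC (delta k))
      (fps_scale (alpha k) (Tconvergent alpha delta N' k.+1))))
  else fps0.

(* F is the T-type continued fraction with coefficients alpha_n, delta_n
   (n >= 1; the values at 0 are not used), i.e. the limit of its truncations
   in the ring of formal power series. *)
Definition is_Tfraction (alpha delta : nat -> R) (F : fps R) : Prop :=
  forall n : nat, exists N0 : nat, forall N : nat, (N0 <= N)%N ->
    Tconvergent alpha delta N 1 n = F n.

End PowerSeries.

(* Main.v *)
(* Read a permutation s of [2n] one index at a time, keeping after i steps the
   first return map of s on {1, ..., i} together with the set of its k "fictive"
   arrows, those that hide indices larger than i.  Adding index i + 1 either
   creates a new cycle or cuts one of the k fictive arrows, so a cycle is counted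
   when its smallest element appears.  The record status of sigma^-1(i) (resp. the
   antirecord status of i) at a double rise (resp. a peak or double fall) only
   says whether the chosen arrow has the smallest source (resp. target), and at a
   fixed point only whether k = 0.  Hence the sum of the weights is that of walks
   in k: an odd index gives a step k -> k + 1 of weight (lam + k) y1 or k -> k, an
   even index a step k -> k - 1 of weight x1 + (k - 1) u1 or k -> k.

   If g_j denotes the tail of the continued fraction from level j on, the walks
   starting from k have a generating function proportional to
   t^k g_1 g_2 ... g_(2k+1), because g_j = 1 + t g_j (delta_j + alpha_j g_(j+1)). *)

Require Import Defs.
From HB Require Import structures.
From mathcomp Require Import all_boot all_order all_algebra all_fingroup.
From mathcomp Require Import ring zify.

Set Implicit Arguments.
Unset Strict Implicit.
Unset Printing Implicit Defensive.

Import GRing.Theory.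

Local Open Scope ring_scope.

(** * The continued fraction *)

Section PowerSeriesProducts.
Variable R : comNzRingType.
Implicit Types f g h : fps R.

(** Truncation transfers the ring laws of polynomials to power series. *)
Lemma fps_mul_coefM f g N n : (n < N)%N ->
  fps_mul f g n = ((\poly_(i < N) f i) * (\poly_(i < N) g i))`_n.
Proof.
move=> ltnN; rewrite coefM; apply: eq_bigr => i _.
by rewrite !coef_poly !(leq_ltn_trans _ ltnN) ?leq_subr // -ltnS.
Qed.

Lemma fps_mul_ext f f' g g' : f =1 f' -> g =1 g' -> fps_mul f g =1 fps_mul f' g'.
Proof. by move=> eqf eqg n; apply: eq_bigr => i _; rewrite eqf eqg. Qed.

Lemma fps_mulC f g : fps_mul f g =1 fps_mul g f.
Proof. by move=> n; rewrite !(@fps_mul_coefM _ _ n.+1) // mulrC. Qed.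

Lemma fps_mulA f g h : fps_mul f (fps_mul g h) =1 fps_mul (fps_mul f g) h.
Proof.
move=> n; rewrite (@fps_mul_coefM f _ n.+1) // (@fps_mul_coefM _ h n.+1) //.
have trunc (u v : fps R) : forall k, (k < n.+1)%N ->
    (\poly_(i < n.+1) fps_mul u v i)`_k =
    ((\poly_(i < n.+1) u i) * (\poly_(i < n.+1) v i))`_k.
  by move=> k lekn; rewrite coef_poly lekn; exact: fps_mul_coefM.
transitivity (((\poly_(i < n.+1) f i) * ((\poly_(i < n.+1) g i) *
                (\poly_(i < n.+1) h i)))`_n).
  rewrite !coefM; apply: eq_bigr => i _; congr (_ * _); apply: trunc.
  by rewrite ltnS leq_subr.
by rewrite mulrA !coefM; apply: eq_bigr => i _; congr (_ * _); rewrite trunc.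
Qed.

Lemma fps_mul1 f : fps_mul (fpsC 1) f =1 f.
Proof.
move=> n; rewrite /fps_mul big_ord_recl mul1r subn0 big1 ?addr0 // => i _.
by rewrite mul0r.
Qed.

Lemma fps_mulDr f g h :
  fps_mul f (fps_add g h) =1 fps_add (fps_mul f g) (fps_mul f h).
Proof.
by move=> n; rewrite /fps_add -big_split; apply: eq_bigr => i _; rewrite mulrDr.
Qed.

Lemma fps_mulZr c f g : fps_mul f (fps_scale c g) =1 fps_scale c (fps_mul f g).
Proof.
by move=> n; rewrite /fps_scale mulr_sumr; apply: eq_bigr => i _; rewrite mulrCA.
Qed.

Lemma fps_mulXr f g : fps_mul f (fps_mulX g) =1 fps_mulX (fps_mul f g).
Proof.
case=> [|n] /=; first by rewrite /fps_mul big_ord1 mulr0.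
rewrite /fps_mul big_ord_recr /= subnn mulr0 addr0; apply: eq_bigr => i _.
by rewrite subSn // -ltnS.
Qed.

Lemma fps_geom_rec h : h 0%N = 0 ->
  fps_geom h =1 fps_add (fpsC 1) (fps_mul (fps_geom h) h).
Proof.
move=> h0 n; rewrite /fps_add -(fps_geomP h0 n) fps_mulC fps_mulDr /fps_add.
by rewrite fps_mulZr /fps_scale fps_mulC fps_mul1 mulN1r subrK.
Qed.

End PowerSeriesProducts.

(** * Products of the tails of the continued fraction *)

Section Ballot.
Variables (R : comNzRingType) (alpha delta : nat -> R).

(* [ballot n j] is the coefficient of [t ^ n] in the product of the tails of
   levels [1], ..., [j] of the continued fraction. *)
Fixpoint ballot (n : nat) : nat -> R :=
  if n is n'.+1 then
    fix aux (j : nat) : R :=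
      if j is j'.+1 then
        aux j' + delta j * ballot n' j + alpha j * ballot n' j.+1
      else 0
  else fun=> 1.

Lemma ballotSS n j : ballot n.+1 j.+1 =
  ballot n.+1 j + delta j.+1 * ballot n j.+1 + alpha j.+1 * ballot n j.+2.
Proof. by []. Qed.

Lemma Tconvergent_rec N k : Tconvergent alpha delta N.+1 k =1
  fps_add (fpsC 1) (fps_mulX
    (fps_add (fps_scale (delta k) (Tconvergent alpha delta N.+1 k))
       (fps_scale (alpha k) (fps_mul (Tconvergent alpha delta N.+1 k)
                                     (Tconvergent alpha delta N k.+1))))).
Proof.
move=> n; rewrite /= fps_geom_rec // /fps_add; congr (_ + _).
set F := fps_geom _.
rewrite fps_mulXr; case: n => //= n.
rewrite (fps_mulDr F) /fps_add -fps_mulZr; congr (_ + _).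
transitivity (fps_mul F (fps_scale (delta k) (fpsC 1)) n).
  by apply: fps_mul_ext => // - [|i]; rewrite /fps_scale /= ?mulr1 ?mulr0.
by rewrite fps_mulZr /fps_scale fps_mulC fps_mul1.
Qed.

(** The depths [M - j'] cut all the tails at the same level [M + 1], so the relation between
    consecutive tails holds exactly for the truncations. *)
Fixpoint tailprod (M j : nat) : fps R :=
  if j is j'.+1 then fps_mul (tailprod M j') (Tconvergent alpha delta (M - j') j)
  else fpsC 1.

Lemma tailprod_rec M j : (j < M)%N -> tailprod M j.+1 =1
  fps_add (tailprod M j) (fps_mulX
    (fps_add (fps_scale (delta j.+1) (tailprod M j.+1))
             (fps_scale (alpha j.+1) (tailprod M j.+2)))).
Proof.
move=> ltjM n; rewrite /= subnS; case: (M - j)%N (subn_gt0 j M) => [|N _].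
  by rewrite ltjM.
set P := tailprod M j; set f := Tconvergent _ _ N.+1 _.
rewrite (fps_mul_ext (fun=> erefl) (Tconvergent_rec N j.+1)) fps_mulDr.
rewrite -/f /fps_add fps_mulC fps_mul1; congr (_ + _).
rewrite fps_mulXr; case: n => //= n.
rewrite (fps_mulDr P) /fps_add !fps_mulZr /fps_scale.
by rewrite -fps_mulA.
Qed.

(** [n + j] never grows along the recurrence, so the truncation is not met. *)
Lemma tailprod_ballot M n j : (n + j <= M)%N -> tailprod M j n = ballot n j.
Proof.
elim: n j => [|n IHn]; elim=> [|j IHj] // le_M.
  by rewrite tailprod_rec // /fps_add IHj ?addr0 // ltnW.
rewrite tailprod_rec; last by lia.
rewrite /fps_add IHj; last by lia.
rewrite ballotSS /fps_mulX /fps_scale !IHn ?addrA //; lia.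
Qed.

Lemma Tconvergent_ballot N n : (n < N)%N ->
  Tconvergent alpha delta N 1 n = ballot n 1.
Proof.
move=> ltnN; rewrite -(@tailprod_ballot N); last by rewrite addn1.
by rewrite /= subn0 fps_mul1.
Qed.

End Ballot.

(** * Walks and their generating functions *)

Section Walks.
Variables (R : comNzRingType) (x1 x2 y1 y2h u1 u2 v2h we wo ze zo lam : R).

Definition up (k : nat) : R := (lam + k%:R) * y1.
Definition down (k : nat) : R := if k is k'.+1 then x1 + k'%:R * u1 else 0.
(** At level 0 there is no arrow to cut: the only level step is a fixed point, which is then a
    record-antirecord. *)
Definition oddlevel (k : nat) : R :=
  if k is k'.+1 then y2h + k'%:R * v2h + lam * wo else lam * zo.
Definition evenlevel (k : nat) : R :=
  if k is k'.+1 then x2 + k'%:R * u2 + lam * we else lam * ze.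

(* [walks r k]: weighted count of the walks of [r] steps from [k] to [0]; the
   last step, and then every other one, is taken at an even label. *)
Fixpoint walks (r k : nat) : R :=
  if r is r'.+1 then
    if odd r' then up k * walks r' k.+1 + oddlevel k * walks r' k
    else evenlevel k * walks r' k + down k * walks r' k.-1
  else (k == 0)%:R.

Variables alpha delta : nat -> R.
Hypothesis alpha_odd : forall k : nat,
  alpha (k.*2.+1) = (lam + k%:R) * (x1 + k%:R * u1) * y1.
Hypothesis alpha_even : forall k : nat,
  alpha (k.+1.*2) = evenlevel k.+1 * oddlevel k.+1.
Hypothesis delta1 : delta 1%N = lam ^+ 2 * ze * zo.
Hypothesis delta_ge2 : forall n : nat, (2 <= n)%N -> delta n = 0.

(** This is the weight of the only walk of [2k] steps from [k] to 0: level at odd labels, down at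
    even ones. *)
Let C k : R := \prod_(l < k) (oddlevel l.+1 * down l.+1).

Lemma walks_ballot n :
  (forall k, walks n.*2 k =
     if (k <= n)%N then C k * ballot alpha delta (n - k) k.*2.+1 else 0) /\
  (forall k, walks n.*2.+1 k.+1 = if (k <= n)%N then
     down k.+1 * C k * ballot alpha delta (n - k) k.+1.*2 else 0).
Proof.
set Q := ballot alpha delta.
have Q0 j : Q 0%N j = 1 by [].
have QS0 p : Q p.+1 0%N = 0 by [].
have QSS p j : Q p.+1 j.+1 =
  Q p.+1 j + delta j.+1 * Q p j.+1 + alpha j.+1 * Q p j.+2 by exact: ballotSS.
clearbody Q.
have oddstep m : (forall k, walks m.*2 k =
     if (k <= m)%N then C k * Q (m - k)%N k.*2.+1 else 0) ->
  forall k, walks m.*2.+1 k.+1 = if (k <= m)%N then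
     down k.+1 * C k * Q (m - k)%N k.+1.*2 else 0.
  move=> IH k; rewrite [LHS]/= odd_double !IH.
  case: ltnP => [ltkm | lemk]; last first.
    rewrite mulr0 add0r; case: ifP => [lekm | _]; last by rewrite mulr0.
    have /eqP -> : (m - k == 0)%N by rewrite subn_eq0.
    by rewrite !Q0 !mulr1.
  (* By the last factors of [C k.+1], the level step gives the term in [alpha (k.+1.*2)]; the step
     down gives the other term. *)
  rewrite (ltnW ltkm) subnS -(prednK (n := (m - k)%N)) ?subn_gt0 // succnK.
  rewrite [in RHS]doubleS [in RHS]QSS delta_ge2 // -doubleS alpha_even.
  rewrite doubleS /C big_ord_recr -/(C k) [down _.+1.-1]/= /=.
  ring.
elim: n => [|n [IHe IHo]].
  have IH0 k : walks 0 k = if (k <= 0)%N then C k * Q (0 - k)%N k.*2.+1 else 0.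
    by case: k => [|k] //=; rewrite /C big_ord0 Q0 mulr1.
  by split=> //; apply: oddstep.
suff IHe' k : walks n.+1.*2 k =
     if (k <= n.+1)%N then C k * Q (n.+1 - k)%N k.*2.+1 else 0.
  by split=> //; apply: oddstep.
have -> : walks n.+1.*2 k =
    up k * walks n.*2.+1 k.+1 + oddlevel k * walks n.*2.+1 k.
  by rewrite doubleS /= odd_double.
rewrite IHo; case: k => [|k].
  (* From 0, a level step at an odd label must be followed by another level step; together they
     weigh [delta 1]. *)
  have -> : walks n.*2.+1 0 = evenlevel 0 * walks n.*2 0.
    by rewrite /= odd_double mul0r addr0.
  rewrite IHe leq0n !subn0 QSS QS0 delta1 (alpha_odd 0) /C big_ord0 /up /=.
  ring.
rewrite IHo ltnS subSS.
case: ltnP => [ltkn | lenk]; last first.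
  rewrite mulr0 add0r; case: ifP => [lekn | _]; last by rewrite mulr0.
  have /eqP -> : (n - k == 0)%N by rewrite subn_eq0.
  by rewrite !Q0 /C big_ord_recr /=; ring.
(* Now [up k.+1 * down k.+2] is the coefficient [alpha (k.+1.*2.+1)]. *)
rewrite (ltnW ltkn) subnS -(prednK (n := (n - k)%N)) ?subn_gt0 // succnK.
rewrite [in RHS]QSS delta_ge2 // alpha_odd.
rewrite -!doubleS /C big_ord_recr -/(C k) /= /up.
ring.
Qed.

Lemma walks0_ballot n : walks n.*2 0 = ballot alpha delta n 1.
Proof. by have [-> _] := walks_ballot n; rewrite subn0 /C big_ord0 mul1r. Qed.

End Walks.
(** * States of a permutation *)

Section LaguerreStates.
Variable m : nat.
Implicit Types (s : 'S_m) (i j a b t : 'I_m) (A B : {set 'I_m}).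

(* The state [(pi, A)] of a permutation [s] at time [n]: [pi] is the first return
   map of [s] on the indices below [n] (and the identity elsewhere), and [A] is
   the set of the [a] below [n] whose arrow [a -> pi a] is fictive, that is,
   stands for a path of [s] through indices at least [n]. *)
Definition state : Type := ('S_m * {set 'I_m})%type.
Implicit Types p q : state.

Definition source i q : 'I_m := sinv q.1 i.

(** Cuts [i] out of its cycle. The arrow that replaces the two arrows at [i] hides [i], hence is
    fictive; if [i] was already fixed, its source is [i] itself and removing [i] leaves no new
    fictive arrow. *)
Definition excise i q : state :=
  ((tperm i (source i q) * q.1)%g, (q.2 :|: [set source i q]) :\ i).

Definition valid (n : nat) q : bool :=
  [forall j : 'I_m, (n <= j)%N ==> (q.1 j == j) && (j \notin q.2)].

(* [q] agrees with the state of [s] at time [n] up to what the weights can see: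
   the first return map itself is only pinned down on real arrows. *)
Definition traces s (n : nat) q : Prop :=
  [/\ forall j, (n <= j)%N -> q.1 j = j,
      q.2 = [set j : 'I_m | (j < n <= s j)%N] &
      forall j, (j < n)%N -> (s j < n)%N -> q.1 j = s j].

Lemma sinvK s : cancel (sinv s) s.
Proof. by move=> i; rewrite /sinv permKV. Qed.

Lemma sinvKV s : cancel s (sinv s).
Proof. by move=> i; rewrite /sinv permK. Qed.

Lemma validP n q : reflect (forall j, (n <= j)%N -> q.1 j = j /\ j \notin q.2)
  (valid n q).
Proof.
apply: (iffP forallP) => [H j lenj | H j]; last first.
  by apply/implyP=> /H [-> ->]; rewrite eqxx.
by have /implyP/(_ lenj)/andP[/eqP] := H j.
Qed.

Lemma fix_ltn n s j : (forall j, (n <= j)%N -> s j = j) -> (j < n)%N -> (s j < n)%N.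
Proof.
move=> fixs ltjn; rewrite ltnNge; apply/negP => lensj.
have eqj := perm_inj (fixs _ lensj).
by move: lensj; rewrite eqj leqNgt ltjn.
Qed.

Lemma fix_sinv n s j : (forall j, (n <= j)%N -> s j = j) ->
  (n <= sinv s j)%N = (n <= j)%N.
Proof.
move=> fixs; apply/idP/idP => lenj; last by rewrite -{1}(fixs j lenj) sinvKV.
by rewrite -(sinvK s j) fixs.
Qed.

Lemma exciseE i q :
  [/\ forall j, j != i -> j != source i q -> (excise i q).1 j = q.1 j,
      (excise i q).1 i = i & (excise i q).1 (source i q) = q.1 i].
Proof.
split=> [j neji neja | |]; rewrite permM ?tpermL ?tpermR //.
  by rewrite tpermD // eq_sym.
exact: sinvK.
Qed.

Lemma traces_excise s i q : traces s i.+1 q -> traces s i (excise i q).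
Proof.
case=> fixq openq realq; have [exD exi _] := exciseE i q.
have source_le : (source i q <= i)%N.
  by rewrite leqNgt (fix_sinv i fixq) ltnn.
(* The arrow of such a [j] is real in [q], so [q.1] and [s] agree on it. *)
have source_out j : (j < i)%N -> (s j <= i)%N -> (j == source i q) = (s j == i).
  move=> ltji lesji; rewrite -realq ?ltnS ?(ltnW ltji) //; apply/esym.
  exact: (can2_eq (sinvKV q.1) (sinvK q.1)).
split.
- move=> j; rewrite leq_eqVlt => /orP[/eqP/val_inj <- // | ltij].
  rewrite exD ?fixq //; apply: contraTneq ltij => ->; first by rewrite ltnn.
  by rewrite -leqNgt.
- apply/setP=> j; rewrite !inE openq !inE.
  case: (ltngtP j i) => [ltji | ltij | /val_inj ->]; last by rewrite eqxx.
    have -> : (j != i) by apply: contraTneq ltji => ->; rewrite ltnn.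
    rewrite /= ltnS (ltnW ltji) /=; case: ltngtP => [ltisj | ltsji | eqsj] //=.
      rewrite source_out ?(ltnW ltsji) //.
      by apply: contraTF ltsji => /eqP ->; rewrite ltnn.
    by rewrite source_out -?eqsj //; apply/eqP/val_inj.
  rewrite ltnS leqNgt ltij /=; apply/negbTE/negP => /andP[_ /eqP eqj].
  by move: source_le; rewrite -eqj leqNgt ltij.
- move=> j ltji ltsji.
  rewrite exD ?realq ?(leqW ltji) ?(leqW ltsji) //.
    by apply: contraTneq ltji => ->; rewrite ltnn.
  rewrite source_out ?(ltnW ltsji) //.
  by apply: contraTneq ltsji => ->; rewrite ltnn.
Qed.

Lemma valid_excise i q : valid i.+1 q -> valid i (excise i q).
Proof.
move=> /validP validq; have [exD exi _] := exciseE i q.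
have source_le : (source i q <= i)%N.
  by rewrite leqNgt (@fix_sinv i.+1 q.1 i) ?ltnn // => j /validq[].
apply/validP => j; rewrite leq_eqVlt => /orP[/eqP/val_inj <- | ltij].
  by rewrite exi !inE eqxx.
have [fixj outj] := validq j ltij.
have neja : j != source i q.
  by apply: contraTneq ltij => ->; rewrite -leqNgt.
have neji : j != i by apply: contraTneq ltij => ->; rewrite ltnn.
by rewrite exD // fixj !inE (negbTE outj) (negbTE neja) andbF.
Qed.

(** Real arrows are arrows of [s], so fictive arrows can be recognized from their targets as well as
    from their sources. *)
Lemma traces_target s n q t : traces s n q -> (t < n)%N ->
  (sinv q.1 t \in q.2) = (n <= sinv s t)%N.
Proof.
case=> fixq openq realq ltn; rewrite openq inE ltnNge fix_sinv // -ltnNge ltn /=.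
have ltqt : (sinv q.1 t < n)%N by rewrite ltnNge fix_sinv // -ltnNge.
apply/idP/idP => [le_n | ].
  rewrite leqNgt; apply/negP => lt_n; move: le_n.
  have -> : sinv q.1 t = sinv s t.
    by apply: (canLR (sinvKV q.1)); rewrite realq // sinvK.
  by rewrite sinvK leqNgt ltn.
apply: contraTT; rewrite -!ltnNge => lt_n.
have := realq _ ltqt lt_n; rewrite sinvK => {1}->.
by rewrite sinvKV.
Qed.

(** The transposition splits [i] off the cycle that it shares with its source, and is trivial when
    [i] is fixed. *)
Lemma porbits_excise i q :
  #|porbits (excise i q).1| = (#|porbits q.1| + (source i q != i))%N.
Proof.
have := porbits_mul_tperm q.1 i (source i q).
have -> : i \in porbit q.1 (source i q).
  by apply/porbitP; exists 1%N; rewrite expg1 sinvK.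
by rewrite /= addn0 eq_sym.
Qed.

Definition minsource p a : bool := [forall b in p.2, (a <= b)%N].
Definition mintarget p a : bool := [forall b in p.2, (p.1 a <= p.1 b)%N].

(** * Cycle and record types of an index, read on its state *)

Section Trace.
Variables (s : 'S_m) (i : 'I_m) (q : state).
Hypothesis tr : traces s i.+1 q.
Let p := excise i q.
Let a := source i q.

Lemma trace_open : (i \in q.2) = (i < s i)%N.
Proof. by case: tr => _ -> _; rewrite inE ltnSn. Qed.

Lemma trace_source_le : (a <= i)%N.
Proof. by case: tr => fixq _ _; rewrite leqNgt (fix_sinv i fixq) ltnn. Qed.

Lemma trace_source_open : (a \in q.2) = (i < sinv s i)%N.
Proof. exact: traces_target tr (ltnSn i). Qed.

Lemma trace_source_real : a \notin q.2 -> a = sinv s i.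
Proof.
rewrite trace_source_open -leqNgt => le_i; case: tr => _ _ realq.
by apply: (canLR (sinvKV q.1)); rewrite realq ?sinvK ?ltnS.
Qed.

Lemma trace_open_source b :
  (b \in p.2) = (b < i <= s b)%N.
Proof. by case: (traces_excise tr) => _ -> _; rewrite inE. Qed.

Lemma trace_target_real : i \notin q.2 -> p.1 a = s i.
Proof.
have [_ _ ->] := exciseE i q.
by rewrite trace_open -leqNgt => le_i; case: tr => _ _ ->.
Qed.

Lemma trace_open_target t : (t < i)%N ->
  (sinv p.1 t \in p.2) = (i <= sinv s t)%N.
Proof. exact: traces_target (traces_excise tr). Qed.

Lemma trace_target_lt b : (b < i)%N -> (p.1 b < i)%N.
Proof. by case: (traces_excise tr) => fixp _ _; apply: fix_ltn. Qed.

(** An index [j < a] prevents [a] from being a record when [s j > i], that is, when [j] is the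
    source of a fictive arrow of [p]. *)
Lemma trace_minsource : s a = i -> minsource p a = record s a.
Proof.
move=> sai; apply/forall_inP/forallP => [mina j | rec b].
  apply/implyP=> ltja; rewrite sai ltnNge; apply: contraL (ltja) => leisj.
  rewrite -leqNgt mina // trace_open_source leisj andbT.
  exact: leq_trans ltja trace_source_le.
rewrite trace_open_source => /andP[_ leisb]; rewrite leqNgt.
by apply: contraL leisb => /(implyP (rec b)); rewrite sai -ltnNge.
Qed.

(** If [j > i] prevents [i] from being an antirecord, then [s j < s i <= i], so [s j] is the target
    of a fictive arrow of [p], below the target [s i] of [a]. *)
Lemma trace_mintarget : i \notin q.2 -> mintarget p a = antirecord s i.
Proof.
move=> outi; have eqt := trace_target_real outi.
have le_si : (s i <= i)%N by rewrite leqNgt -trace_open.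
apply/forall_inP/forallP => [mint j | antirec b].
  apply/implyP=> ltij; rewrite ltnNge; apply/negP => lesj.
  have ltsj : (s j < s i)%N.
    rewrite ltn_neqAle lesj andbT; apply: contraTneq ltij => /val_inj /perm_inj ->.
    by rewrite ltnn.
  have ltsji := leq_trans ltsj le_si.
  have /mint : sinv p.1 (s j) \in p.2.
    by rewrite trace_open_target // sinvKV ltnW.
  by rewrite sinvK eqt leqNgt ltsj.
move=> openb; have := openb; rewrite trace_open_source => /andP[ltbi _].
have ltpb := trace_target_lt ltbi.
have := trace_open_target ltpb; rewrite sinvKV openb eqt => /esym leib.
rewrite leqNgt; apply/negP => lt_pb.
have ltib : (i < sinv s (p.1 b))%N.
  rewrite ltn_neqAle leib andbT; apply: contraTneq lt_pb => /val_inj eqi.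
  by rewrite {1}eqi sinvK ltnn.
have /implyP/(_ ltib) := antirec (sinv s (p.1 b)); rewrite sinvK.
by rewrite ltnNge ltnW.
Qed.

Lemma trace_fix_record : s i = i -> record s i = (p.2 == set0).
Proof.
move=> fixi; apply/forallP/eqP => [rec | none j].
  apply/setP => b; rewrite trace_open_source inE.
  by apply/negP => /andP[/(implyP (rec b))]; rewrite fixi ltnNge => /negP.
apply/implyP=> ltji; have := trace_open_source j.
by rewrite none inE ltji fixi ltnNge /= => <-.
Qed.

(** The target of [a] in [p] is then [i], which exceeds the target of every fictive arrow. *)
Lemma trace_fix_antirecord : s i = i -> antirecord s i = (p.2 == set0).
Proof.
move=> fixi; have outi : i \notin q.2 by rewrite trace_open fixi ltnn.
rewrite -trace_mintarget //; have eqt := trace_target_real outi.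
apply/forall_inP/eqP => [mint | none b]; last by rewrite none in_set0.
apply/setP=> b; rewrite in_set0; apply/negP => openb; move: (mint b openb).
rewrite eqt fixi leqNgt trace_target_lt //.
by move: openb; rewrite trace_open_source => /andP[].
Qed.

(** The types of [i] correspond to which of the arrows into and out of [i] are fictive; each type
    other than a fixed point rules out one record status. *)
Lemma trace_cval : i \in q.2 -> a \in q.2 -> cval s i /\ ~~ antirecord s i.
Proof.
rewrite trace_open trace_source_open => lt1 lt2; split; first exact/andP.
apply/forallPn; exists (sinv s i).
by rewrite negb_imply lt2 sinvK -leqNgt ltnW.
Qed.

Lemma trace_cdrise : i \in q.2 -> a \notin q.2 -> cdrise s i /\ ~~ antirecord s i.
Proof.
move=> openi outa; have ltisi : (i < s i)%N by rewrite -trace_open.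
have neai : a != i by apply: contraNneq outa => ->.
have ltai : (a < i)%N.
  by rewrite ltn_neqAle trace_source_le andbT.
split; first by rewrite /cdrise -(trace_source_real outa) ltai.
have ltqi : (q.1 i < i)%N.
  have [_ _ <-] := exciseE i q; exact: trace_target_lt.
(* The fictive arrow out of [i] ends at [q.1 i < i], whose predecessor under [s] lies above [i]. *)
have /traces_target/(_ (leqW ltqi)) := tr; rewrite sinvKV openi => /esym leq.
apply/forallPn; exists (sinv s (q.1 i)); rewrite negb_imply leq sinvK -leqNgt.
exact: ltnW (ltn_trans ltqi ltisi).
Qed.

Lemma trace_cdfall : i \notin q.2 -> a \in q.2 -> cdfall s i /\ ~~ record s i.
Proof.
move=> outi opena; have lesi : (s i <= i)%N by rewrite leqNgt -trace_open.
have ltinv : (i < sinv s i)%N by rewrite -trace_source_open.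
have neai : a != i by apply: contraNneq outi => <-.
have ltsi : (s i < i)%N.
  rewrite ltn_neqAle lesi andbT; apply: contraTneq ltinv => /val_inj eqi.
  by rewrite -{2}eqi sinvKV ltnn.
split; first exact/andP.
apply/forallPn; exists a; rewrite negb_imply ltn_neqAle trace_source_le neai /=.
case: tr opena => _ -> _; rewrite inE -leqNgt => /andP[_ ltisa].
exact: leq_trans (ltnW ltsi) (ltnW ltisa).
Qed.

Lemma trace_cpeak : i \notin q.2 -> a \notin q.2 -> a != i ->
  cpeak s i /\ ~~ record s i.
Proof.
move=> outi outa neai; have lesi : (s i <= i)%N by rewrite leqNgt -trace_open.
have eqa := trace_source_real outa.
have ltai : (a < i)%N by rewrite ltn_neqAle trace_source_le andbT.
have ltsi : (s i < i)%N.
  rewrite ltn_neqAle lesi andbT; apply: contra neai => /eqP/val_inj eqi.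
  by rewrite eqa -{1}eqi sinvKV.
split; first by rewrite /cpeak -eqa ltai.
apply/forallPn; exists a; rewrite negb_imply ltai eqa sinvK -leqNgt.
exact: ltnW.
Qed.

Lemma trace_fix : a \notin q.2 -> a = i -> s i = i.
Proof. by move=> outa eqai; rewrite -{1}eqai (trace_source_real outa) sinvK. Qed.

End Trace.

End LaguerreStates.
(** * Transfer of weights along the states *)

Section Sums.
Variable R : comNzRingType.
Implicit Type T : finType.

Lemma sum_setD1_eq T (a : T) (A : {set T}) (f : {set T} -> R) : a \notin A ->
  \sum_(B : {set T} | B :\ a == A) f B = f A + f (a |: A).
Proof.
move=> outa; rewrite (bigD1 A) /=; last first.
  by apply/eqP/setP=> b; rewrite !inE; case: eqP => [-> | //]; rewrite (negbTE outa).
congr (_ + _); rewrite (big_pred1 (a |: A)) // => B /=.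
apply/andP/eqP => [[/eqP defA neBA] | ->].
  rewrite -defA setD1K //; apply: contraNT neBA => outB.
  rewrite -defA; apply/eqP/setP=> b; rewrite !inE.
  by case: eqP => [-> | //]; rewrite (negbTE outB).
split; first by rewrite setU1K.
by apply: contraNneq outa => <-; rewrite setU11.
Qed.

Lemma sum_setU1_eq T (a : T) (A : {set T}) (f : {set T} -> R) : a \in A ->
  \sum_(B : {set T} | B :|: [set a] == A) f B = f A + f (A :\ a).
Proof.
move=> ina; rewrite addrC -[in f A](setD1K ina).
rewrite -(@sum_setD1_eq T a (A :\ a)) ?setD11 //.
apply: eq_bigl => B; apply/eqP/eqP => [<- | /setP eqB].
  by apply/setP=> b; rewrite !inE; case: eqP; rewrite ?orbF.
apply/setP=> b; move: (eqB b); rewrite !inE.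
by case: eqP => [-> | //]; rewrite ?orbT ?ina //= orbF.
Qed.

(** By injectivity exactly one element of a nonempty [A] is minimal. *)
Lemma sum_argmin T (A : {set T}) (g : T -> nat) (c d : R) : injective g ->
  \sum_(a in A) (if [forall b in A, (g a <= g b)%N] then c else d) =
  if #|A| is k.+1 then c + k%:R * d else 0.
Proof.
move=> injg; case: (set_0Vmem A) => [-> | [a0 ina0]].
  by rewrite big_set0 cards0.
case: (arg_minnP g ina0) => a /= ina mina.
have {}ina : a \in A by [].
rewrite (bigD1 a) //= (cardsD1 a) ina /=; congr (_ + _).
  by rewrite ifT //; apply/forall_inP.
rewrite (eq_bigr (fun=> d)) => [|b /andP[inb neba]]; last first.
  rewrite ifF //; apply/negbTE/forall_inPn; exists a => //.
  rewrite -ltnNge ltn_neqAle mina // andbT; apply: contra neba => /eqP/injg ->.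
  exact: eqxx.
rewrite sumr_const mulr_natl; congr (_ *+ _).
by apply: eq_card => b; rewrite !inE andbC.
Qed.

Lemma exprn_card_prod T (P : pred T) (x : R) :
  x ^+ #|[set i | P i]| = \prod_i x ^+ P i.
Proof.
rewrite -prodr_const big_mkcond; apply: eq_bigr => i _.
by rewrite inE; case: (P i).
Qed.
End Sums.

Section WeightedStates.
Variables (R : comNzRingType) (x1 x2 y1 y2h u1 u2 v2h we wo ze zo lam : R).
Variable m : nat.
Implicit Types (s : 'S_m) (i j a b : 'I_m) (B : {set 'I_m}) (p q : state m).

(* The factor contributed by index [i] when it is inserted in the state [p] just
   after [a] ([a = i] for a new cycle) and [B] is the new set of fictive arrows;
   the factor [lam] of a new cycle is left to [step_weight]. *)
Definition local_weight i p a B : R :=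
  if odd (lab i) then
    if i \in B then
      if a \in B then y1 else if minsource p a then y2h else v2h
    else if (a \notin B) && (a == i) then
      if p.2 == set0 then zo else wo
    else 0
  else
    if i \in B then 0
    else if a \in B then
      if mintarget p a then x2 else u2
    else if a == i then
      if p.2 == set0 then ze else we
    else if mintarget p a then x1 else u1.

Definition step_weight i p a B : R := lam ^+ (a == i) * local_weight i p a B.

Let walks := walks x1 x2 y1 y2h u1 u2 v2h we wo ze zo lam.

(* [i] is either a new cycle, fictive or not, or it cuts a fictive arrow
   [a -> pi a] into [a -> i -> pi a], each half being fictive or not. *)
Lemma sum_over_extensions i p (f : 'I_m -> {set 'I_m} -> R) : valid i p ->
  \sum_(q | valid i.+1 q && (excise i q == p)) f (source i q) q.2 =
  f i p.2 + f i (i |: p.2) +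
  \sum_(a in p.2) (f a p.2 + f a (p.2 :\ a) +
                   (f a (i |: p.2) + f a (i |: (p.2 :\ a)))).
Proof.
case: p => pi A /validP /= validp.
have outi : i \notin A by case: (validp i).
(* Applying the same transposition again undoes the excision, so an extension is determined by the
   source of [i] and the new set. *)
pose h (c : 'I_m * {set 'I_m}) : state m := ((tperm i c.1 * pi)%g, c.2).
have source_h c : source i (h c) = c.1.
  apply: (canLR (sinvKV _)); rewrite permM tpermR.
  by case: (validp i (leqnn i)).
rewrite (reindex_onto h (fun q => (source i q, q.2))) /=; last first.
  case=> pi1 A1 /andP[_ /eqP[/= eqpi _]].
  by rewrite /h /= -eqpi mulgA tperm2 mul1g.
transitivity (\sum_(a | (a == i) || (a \in A))
                \sum_(B : {set 'I_m} | (B :|: [set a]) :\ i == A) f a B).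
  rewrite pair_big_dep; apply: eq_big => [[a B] | c _]; last first.
    by rewrite source_h.
  rewrite source_h /= eqxx andbT /excise source_h /= mulgA tperm2 mul1g.
  rewrite xpair_eqE eqxx /= [RHS]andbC [LHS]andbC; case: eqP => //= defA.
  apply/validP/idP => [validq | ina j ltij].
    rewrite -defA !inE eqxx orbT andbT; exact: orbN.
  have [fixj] := validp j (ltnW ltij); rewrite -defA !inE.
  have neji : j != i by apply: contraTneq ltij => ->; rewrite ltnn.
  rewrite neji negb_or => /andP[outj neja]; split=> //=.
  by rewrite permM tpermD // eq_sym.
rewrite (bigD1 i) /=; last by rewrite eqxx.
(* The two set operations are inverted one at a time; each has two preimages. *)
have inner a : \sum_(B : {set 'I_m} | (B :|: [set a]) :\ i == A) f a B =
    \sum_(D : {set 'I_m} | D :\ i == A)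
      \sum_(B : {set 'I_m} | B :|: [set a] == D) f a B.
  rewrite (partition_big (fun B => B :|: [set a]) (fun D => D :\ i == A)) //=.
  apply: eq_bigr => D /eqP <-; apply: eq_bigl => B.
  by apply/andP/idP => [[]|/eqP ->].
congr (_ + _).
  rewrite -(sum_setD1_eq _ outi); apply: eq_bigl => B; congr (_ == _).
  by apply/setP=> b; rewrite !inE; case: eqP; rewrite ?orbF.
apply: eq_big => [a | a /andP[/predU1P[-> /eqP // | ina] _]].
  by case: eqP => [-> | _] /=; rewrite ?(negbTE outi) // andbT.
have neai : a != i by apply: contraNneq outi => <-.
rewrite inner sum_setD1_eq // sum_setU1_eq // sum_setU1_eq ?setU1r //.
congr (_ + (_ + f a _)); apply/setP=> b; rewrite !inE.
by case: (altP (b =P i)) => [-> | //]; rewrite eq_sym neai.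
Qed.

Lemma step_weight_sum i p r : m = (i + r.+1)%N -> ~~ odd m -> valid i p ->
  \sum_(q | valid i.+1 q && (excise i q == p))
     step_weight i p (source i q) q.2 * walks r #|q.2| = walks r.+1 #|p.2|.
Proof.
move=> def_m evenm validp.
rewrite (@sum_over_extensions i p (fun a B => step_weight i p a B * walks r #|B|)) //.
have [_ outi] := elimT (validP i p) validp i (leqnn i).
(* As [m] is even, the number of remaining steps gives the parity of the label. *)
have odd_lab : odd (lab i) = odd r.
  have: ~~ odd (i + r.+1) by rewrite -def_m.
  by rewrite addnS /= negbK oddD; case: odd; case: odd.
have neai a : a \in p.2 -> (a == i) = false.
  by move=> ina; apply: contraNF outi => /eqP <-.
have card_in a : a \in p.2 -> #|p.2 :\ a| = #|p.2|.-1.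
  by move=> ina; rewrite (cardsD1 a p.2) ina.
have card_iin a : a \in p.2 -> #|i |: (p.2 :\ a)| = #|p.2|.
  by move=> ina; rewrite cardsU1 card_in // !inE (negbTE outi) andbF (cardsD1 a p.2) ina.
have cardU : #|i |: p.2| = #|p.2|.+1 by rewrite cardsU1 outi.
rewrite /walks [RHS]/= -/walks.
rewrite /step_weight /local_weight odd_lab eqxx expr1 cardU !inE eqxx outi.
rewrite (negbTE outi) /=.
have eq0 : (p.2 == set0) = (#|p.2| == 0)%N by rewrite cards_eq0.
case: ifP => _.
  transitivity ((lam * if p.2 == set0 then zo else wo) * walks r #|p.2| +
     lam * y1 * walks r #|p.2|.+1 +
     ((\sum_(a in p.2) y1) * walks r #|p.2|.+1 +
     (\sum_(a in p.2) if minsource p a then y2h else v2h) * walks r #|p.2|)).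
    congr (_ + _); rewrite 2!mulr_suml -big_split; apply: eq_bigr => a ina.
    by rewrite neai // ina card_iin // !inE neai // eqxx ina (negbTE outi) /=
            expr0 andbF eqxx /= !(mul1r, mul0r, add0r).
  rewrite sumr_const -[y1 *+ _]mulr_natl (sum_argmin _ _ _ val_inj) eq0 /up /oddlevel.
  by case: #|p.2| => [|k] /=; ring.
transitivity ((lam * if p.2 == set0 then ze else we) * walks r #|p.2| +
    ((\sum_(a in p.2) if mintarget p a then x2 else u2) * walks r #|p.2| +
    (\sum_(a in p.2) if mintarget p a then x1 else u1) * walks r #|p.2|.-1)).
  rewrite mulr0 mul0r addr0; congr (_ + _).
  rewrite 2!mulr_suml -big_split; apply: eq_bigr => a ina.
  by rewrite neai // card_in // ina !inE eqxx (negbTE outi) /= andbF /=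
             expr0 !(mul1r, mulr0, mul0r, addr0) eqxx /= mul0r !addr0.
have injt : injective (fun a => p.1 a : nat) by move=> a b /val_inj /perm_inj.
rewrite !(sum_argmin _ _ _ injt) eq0 /evenlevel /down.
by case: #|p.2| => [|k] /=; ring.
Qed.

(** Excision determines the whole history of a state; this is the product of its step weights. The
    default 0 arises only for [n > m]. *)
Fixpoint prefix_weight (n : nat) q : R :=
  if n is n'.+1 then
    if insub n' is Some i then
      step_weight i (excise i q) (source i q) q.2 * prefix_weight n' (excise i q)
    else 0
  else 1.

Lemma prefix_weightS i q : prefix_weight i.+1 q =
  step_weight i (excise i q) (source i q) q.2 * prefix_weight i (excise i q).
Proof. by rewrite /= valK. Qed.

Lemma prefix_weight_total : ~~ odd m ->
  \sum_(q | q.2 == set0) prefix_weight m q = walks m 0.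
Proof.
move=> evenm.
(* [G] is constant in [n]: weights of the past times walks for the future. At [m] it is the sum
   wanted, at 0 a single state remains. *)
pose G n := \sum_(q | valid n q) prefix_weight n q * walks (m - n) #|q.2|.
have GS n : (n < m)%N -> G n.+1 = G n.
  move=> ltnm; pose i := Ordinal ltnm.
  have def_m : m = (i + (m - n.+1).+1)%N by rewrite /= subnSK // subnKC // ltnW.
  rewrite /G (partition_big (excise i) (valid n)) => [|q]; last first.
    exact: (@valid_excise m i).
  apply: eq_bigr => p validp.
  rewrite -(subnSK ltnm) -(step_weight_sum def_m) // mulr_sumr.
  apply: eq_bigr => q /andP[_ /eqP eqp].
  by rewrite (prefix_weightS i) eqp /=; ring.
have Gm n : (n <= m)%N -> G n = G 0%N.
  by elim: n => // n IHn ltnm; rewrite GS // IHn // ltnW.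
transitivity (G m).
  rewrite /G subnn [RHS](bigID (fun q => q.2 == set0)) /=.
  rewrite [X in _ + X]big1 ?addr0 => [|q /andP[_ neq0]]; last first.
    by rewrite cards_eq0 (negbTE neq0) mulr0.
  apply: eq_big => [q | q /eqP ->]; last by rewrite cards0 mulr1.
  rewrite andb_idl // => _; apply/validP => j.
  by rewrite leqNgt ltn_ord.
rewrite Gm // /G subn0 (big_pred1 (1%g, set0)) => [|[pi A]] /=.
  by rewrite mul1r cards0.
apply/validP/eqP => /= [valid0 | [-> ->] j _]; last by rewrite perm1 inE.
by congr pair; [apply/permP | apply/setP] => j; have [] := valid0 j isT;
  rewrite ?perm1 // inE => _ /negbTE.
Qed.

(** The leading factor is 0 or 1 and tests membership in the class index by index, so sums can run
    over all permutations. *)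
Definition index_weight s i : R :=
  (if odd (lab i) then lab i <= lab (s i) else lab (s i) <= lab i)%N%:R *
  (x1 ^+ (earec s i && cpeak s i) * x2 ^+ (earec s i && cdfall s i) *
   y1 ^+ (erec s i && cval s i) * y2h ^+ (cdrise s i && record s (sinv s i)) *
   u1 ^+ (nrar s i && cpeak s i) * u2 ^+ (nrar s i && cdfall s i) *
   y1 ^+ (nrar s i && cval s i) *
   v2h ^+ (cdrise s i && ~~ record s (sinv s i)) *
   we ^+ [&& ~~ odd (lab i), fixpt s i & nrar s i] *
   wo ^+ [&& odd (lab i), fixpt s i & nrar s i] *
   ze ^+ (~~ odd (lab i) && rar s i) * zo ^+ (odd (lab i) && rar s i)).

(** The state does not tell whether a cycle valley is a record; this is harmless because both kinds
    of valley weigh [y1]. *)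
Lemma traces_local_weight s i q : traces s i.+1 q ->
  local_weight i (excise i q) (source i q) q.2 = index_weight s i.
Proof.
move=> tr; rewrite /local_weight /index_weight /lab !ltnS.
rewrite /earec /erec /nrar /rar /cpeak /cdfall /cval /cdrise /fixpt.
move: (odd i.+1) => b.
have [openi | outi] := boolP (i \in q.2);
  have [opena | outa] := boolP (source i q \in q.2).
- have [/andP[c1 c2] nanti] := trace_cval tr openi opena.
  rewrite -[s i == i]val_eqE (gtn_eqF c2) c1 c2 !(leq_gtF (ltnW c1), leq_gtF (ltnW c2)).
  rewrite (ltnW c2) (ltn_geF c2) (negbTE nanti).
  by case: b; case: (record s i);
     rewrite /= ?(expr0, expr1, mul1r, mulr1, mul0r).
- have [/andP[c1 c2] nanti] := trace_cdrise tr openi outa.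
  rewrite (trace_minsource tr) (trace_source_real tr outa) ?sinvK //.
  rewrite -[s i == i]val_eqE (gtn_eqF c2) c1 c2 !(leq_gtF (ltnW c1), leq_gtF (ltnW c2)).
  rewrite (ltnW c2) (ltn_geF c2) (negbTE nanti).
  by case: b; case: (record s i); case: (record s _);
     rewrite /= ?(expr0, expr1, mul1r, mulr1, mul0r).
- have [/andP[c1 c2] nrec] := trace_cdfall tr outi opena.
  rewrite (trace_mintarget tr) //.
  rewrite -[s i == i]val_eqE (ltn_eqF c2) c1 c2 !(leq_gtF (ltnW c1), leq_gtF (ltnW c2)).
  rewrite (ltnW c2) (ltn_geF c2) (negbTE nrec).
  by case: b; case: (antirecord s i);
     rewrite /= ?(expr0, expr1, mul1r, mulr1, mul0r).
- have [eqai | neai] := eqVneq.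
  + have fixi := trace_fix tr outa eqai.
    rewrite (trace_fix_record tr fixi) (trace_fix_antirecord tr fixi).
    rewrite fixi eqxx !ltnn !leqnn !andbF.
    by case: b; case: (_ == set0);
       rewrite /= ?(expr0, expr1, mul1r, mulr1).
  + have [/andP[c1 c2] nrec] := trace_cpeak tr outi outa neai.
    rewrite (trace_mintarget tr) //.
    rewrite -[s i == i]val_eqE (ltn_eqF c2) c1 c2 !(leq_gtF (ltnW c1), leq_gtF (ltnW c2)).
    rewrite (ltnW c2) (ltn_geF c2) (negbTE nrec).
    by case: b; case: (antirecord s i);
       rewrite /= ?(expr0, expr1, mul1r, mulr1, mul0r).
Qed.

(** The [m - n] indices not yet inserted are fixed points of [q.1]; [c] counts the other cycles, one
    for each insertion with [a = i]. *)
Lemma prefix_weight_traces s n q : (n <= m)%N -> traces s n q ->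
  exists2 c, #|porbits q.1| = (c + (m - n))%N &
    prefix_weight n q = lam ^+ c * \prod_(i : 'I_m | (i < n)%N) index_weight s i.
Proof.
elim: n q => [|n IHn] q lenm tr.
  exists 0%N; last by rewrite big1 ?mulr1 // => i; rewrite ltn0.
  have -> : q.1 = 1%g.
    by case: tr => fixq _ _; apply/permP => j; rewrite perm1 fixq.
  rewrite subn0 add0n /porbits card_imset ?card_ord // => i j.
  by move/eqP; rewrite eq_porbit_mem => /porbitP[k ->]; rewrite expg1n perm1.
pose i := Ordinal lenm; have tr' : traces s i.+1 q by [].
have [c eqc eqw] := IHn (excise i q) (ltnW lenm) (traces_excise tr').
exists (c + (source i q == i))%N.
  move: eqc; rewrite porbits_excise -(subnSK lenm) /=.
  by case: (source i q == i) => /=; lia.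
rewrite (prefix_weightS i) eqw /step_weight (traces_local_weight tr').
rewrite exprD [in RHS](bigD1 i) //=.
rewrite [in RHS](eq_bigl (fun j : 'I_m => (j < n)%N)) => [|j].
  by rewrite mulrACA; congr (_ * _); rewrite mulrC.
by rewrite ltnS ltn_neqAle andbC.
Qed.

(** At time [m] nothing is hidden: the states without fictive arrows are the permutations
    themselves. *)
Lemma sum_Dperm_walks : ~~ odd m ->
  \sum_s (\prod_i index_weight s i) * lam ^+ cyc s = walks m 0.
Proof.
move=> evenm; rewrite -prefix_weight_total //.
rewrite (reindex_onto (fun s => (s, set0) : state m) (fun q => q.1)) /=.
  apply: eq_big => [s | s _]; first by rewrite !eqxx.
  have tr : traces s m (s, set0).
    split=> //= [j|]; first by rewrite leqNgt ltn_ord.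
    by apply/setP=> j; rewrite !inE ltn_ord leqNgt ltn_ord.
  have [c /= eqc ->] := prefix_weight_traces (leqnn m) tr.
  rewrite mulrC /cyc eqc subnn addn0; congr (_ * _).
  by apply: eq_bigl => i; rewrite ltn_ord.
by case=> s A /= /eqP ->.
Qed.

Lemma prod_index_weight s :
  \prod_i index_weight s i = if Dperm s then
    x1 ^+ eareccpeak s * x2 ^+ eareccdfall s *
    y1 ^+ ereccval s * y2h ^+ ereccdrise' s *
    u1 ^+ nrcpeak s * u2 ^+ nrcdfall s *
    y1 ^+ nrcval s * v2h ^+ nrcdrise' s *
    we ^+ evennrfix s * wo ^+ oddnrfix s *
    ze ^+ evenrar s * zo ^+ oddrar s else 0.
Proof.
rewrite /index_weight; case: ifPn => [/forallP Ds | /forallPn[i nDi]].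
  rewrite !exprn_card_prod -!big_split; apply: eq_bigr => i _.
  by rewrite (Ds i) mul1r.
by rewrite (bigD1 i) // (negbTE nDi) mul0r; apply: mul0r.
Qed.

End WeightedStates.

Theorem theorem4p2 (R : comNzRingType)
    (x1 x2 y1 y2h u1 u2 v2h we wo ze zo lam : R)
    (alpha delta : nat -> R)
    (alpha_odd : forall k : nat, (1 <= k)%N ->
       alpha (2 * k - 1)%N =
         (lam + (k - 1)%:R) * (x1 + (k - 1)%:R * u1) * y1)
    (alpha_even : forall k : nat, (1 <= k)%N ->
       alpha (2 * k)%N =
         (x2 + (k - 1)%:R * u2 + lam * we) *
         (y2h + (k - 1)%:R * v2h + lam * wo))
    (delta1 : delta 1%N = lam ^+ 2 * ze * zo)
    (delta_ge2 : forall n : nat, (2 <= n)%N -> delta n = 0) :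
  is_Tfraction alpha delta
    (fun n : nat =>
       Phathat n x1 x2 y1 y2h u1 u2 y1 v2h we wo ze zo lam).
Proof.
move=> n; exists n.+1 => N ltnN; rewrite Tconvergent_ballot //.
rewrite -(@walks0_ballot R x1 x2 y1 y2h u1 u2 v2h we wo ze zo lam) //; first last.
- by case=> [|k]; rewrite -mul2n alpha_even // subn1.
- by move=> k; rewrite -mul2n -[_.+1](_ : 2 * k.+1 - 1 = _)%N ?alpha_odd ?subn1 //;
    rewrite mulnS.
rewrite -mul2n -sum_Dperm_walks; last by rewrite oddM.
rewrite /Phathat [RHS]big_mkcond; apply: eq_bigr => s _.
by rewrite prod_index_weight; case: ifP; rewrite ?mul0r.
Qed.
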